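(* Let $k,l\ge1$ be integers, $n=k+l$, $c\in\{1,-1,0\}$, and let $J=\mathrm{diag}(J_1,\dots,J_n)$ be a real diagonal matrix with all $J_i\neq0$ and $J_i^2\ne J_j^2$ for $i\neq j$. Then the Heisenberg model, i.e. the map $\Phi$ defined in the context, is a completely integrable discrete Hamiltonian system on the symplectic manifold $(P_c^*,\Omega)$ of dimension $2n-2$.
   Context: Pseudo-Euclidean space: $E^{k,l}$ is $\mathbb R^n$ with scalar product $\langle x,y\rangle=\sum_{i=1}^n\tau_ix_iy_i$, where $\tau_1=\dots=\tau_k=1$, $\tau_{k+1}=\dots=\tau_n=-1$. Phase space: $S_c^{n-1}=\{q\in\mathbb R^n:\langle q,q\rangle=c\}$ (pseudo-sphere for $c=\pm1$, light-like cone for $c=0$), $P_c=S_c^{n-1}\times S_c^{n-1}$ with points $(q,Q)$, and $P_c^*=\{(q,Q)\in P_c:\langle q,J^{-1}Q\rangle\ne0\}$. The 2-form $\Omega=\sum_i\tau_iJ_i\,dQ_i\wedge dq_i$ on $\mathbb R^n\times\mathbb R^n$ restricts to a symplectic form on $P_c^*$, again denoted $\Omega$; Poisson brackets of functions on $P_c^*$ are with respect to this restricted form (equivalently, the Dirac bracket). Heisenberg map: for $(q,Q)\in P_c$ with $\langle J^{-2}Q,Q\rangle\neq0$, $$\Phi(q,Q)=\bigl(Q,\ \lambda J^{-1}Q-q\bigr),\qquad \lambda=\frac{2\langle J^{-1}Q,q\rangle}{\langle J^{-2}Q,Q\rangle}.$$ $\Phi$ is only defined outside the singular set $\{\langle J^{-2}Q,Q\rangle=0\}$;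 where defined it maps into $P_c$ and preserves $P_c^*$. Statements about $\Phi$ are understood on its domain of definition. Complete integrability: a map $\Phi$ on a symplectic manifold of dimension $2m$ (here $m=n-1$) is a completely integrable discrete Hamiltonian system if $\Phi^*\Omega=\Omega$ and there exist $m$ smooth functions $g_1,\dots,g_m$ on the manifold that are integrals of $\Phi$ ($g_i\circ\Phi=g_i$ on the domain of $\Phi$), pairwise Poisson-commute, and are functionally independent (have linearly independent differentials) on an open dense subset. *)

(* Defs.v *)
From mathcomp Require Import all_boot all_order all_algebra.
From mathcomp Require Import all_classical all_reals all_analysis.

Set Implicit Arguments.
Unset Strict Implicit.
Unset Printing Implicit Defensive.

Import Order.TTheory GRing.Theory Num.Theory.
Import numFieldNormedType.Exports.

Local Open Scope classical_set_scope.
Local Open Scope ring_scope.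

(* C^m on an open set U of a finite-dimensional space V. *)
Fixpoint Ck (R : realType) (V W : normedModType R) (m : nat) (U : set V)
    (f : V -> W) : Prop :=
  match m with
  | 0 => forall x, U x -> {for x, continuous f}
  | m'.+1 => (forall x, U x -> differentiable f x) /\
             (forall v, Ck m' U (fun x => 'D_v f x))
  end.

Definition smooth_on (R : realType) (V W : normedModType R) (U : set V)
    (f : V -> W) : Prop :=
  forall m, Ck m U f.

(* A submanifold of V presented as the level set {x in U | f x = c}. *)
Record levelset (R : realType) (V W : normedModType R) := Levelset {
  lev_dom : set V;
  lev_map : V -> W;
  lev_val : W
}.

Section Levelset.
Context {R : realType} {V W : normedModType R} (M : levelset V W).

Definition points : set V := lev_dom M `&` lev_map M @^-1` [set lev_val M].

Definition tangent (p : V) : set V := [set v | 'd (lev_map M) p v = 0].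

Definition has_dim (E : set V) (d : nat) : Prop :=
  exists b : 'I_d -> V,
    let comb (a : 'rV[R]_d) := \sum_i a ord0 i *: b i in
    range comb = E /\ injective comb.

(* The level is regular, so that the points form an embedded submanifold
   with tangent spaces [tangent p], here of dimension d. *)
Definition submanifold (d : nat) : Prop :=
  [/\ open (lev_dom M),
      smooth_on (lev_dom M) (lev_map M),
      forall p, points p -> forall w, exists v, 'd (lev_map M) p v = w
    & forall p, points p -> has_dim (tangent p) d].

(* omega is a 2-form with constant coefficients on V: it is automatically
   closed, so only nondegeneracy of its restriction has to be required. *)
Definition symplectic_manifold (omega : V -> V -> R) (d : nat) : Prop :=
  [/\ submanifold d,
      forall a u v w, omega (a *: u + v) w = a * omega u w + omega v w,
      forall a u v w, omega w (a *: u + v) = a * omega w u + omega w v,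
      forall v, omega v v = 0
    & forall p, points p -> forall u, tangent p u ->
        (forall v, tangent p v -> omega u v = 0) -> u = 0].

(* Functions on the manifold are represented by functions on V, of which only
   the values on [points] and the differentials on [tangent p] are used. The
   Hamiltonian vector field X_g is the tangent field with
   omega (X_g, v) = dg (v) for all tangent v; it is unique when the restricted
   form is nondegenerate. *)
Definition ham_vec (omega : V -> V -> R) (g : V -> R) (p : V) : V :=
  get [set X | tangent p X /\
               forall v, tangent p v -> omega X v = 'd g p v].

Definition poisson (omega : V -> V -> R) (f g : V -> R) (p : V) : R :=
  omega (ham_vec omega f p) (ham_vec omega g p).

(* Linear independence of the differentials at p, restricted to [tangent p]. *)
Definition independent_at (m : nat) (g : 'I_m -> V -> R) (p : V) : Prop :=
  forall a : 'I_m -> R,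
    (forall v, tangent p v -> \sum_i a i * 'd (g i) p v = 0) ->
    forall i, a i = 0.

(* Phi is a partial map, defined on D. A smooth function on the manifold is
   the restriction of a smooth function on a neighbourhood of it in V. *)
Definition completely_integrable (omega : V -> V -> R) (D : set V)
    (Phi : V -> V) (m : nat) : Prop :=
  [/\ symplectic_manifold omega (2 * m)%N,
      open D /\ smooth_on D Phi,
      forall p, points p -> D p -> points (Phi p),
      (forall p, points p -> D p -> forall u v, tangent p u -> tangent p v ->
         omega ('d Phi p u) ('d Phi p v) = omega u v)
    & exists g : 'I_m -> V -> R,
        [/\ exists O, [/\ open O, points `<=` O
                        & forall i, smooth_on O (g i)],
            forall i p, points p -> D p -> g i (Phi p) = g i p,
            forall i j p, points p -> poisson omega (g i) (g j) p = 0
          & exists O, [/\ open O, points `<=` closure (points `&` O)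
                        & forall p, points p -> O p -> independent_at g p]]].

End Levelset.

Section Heisenberg.
Context {R : realType} {k l : nat}.
Implicit Types (J : 'rV[R]_(k + l)) (x y q Q : 'cV[R]_(k + l)).

Definition tau (i : 'I_(k + l)) : R := if (i < k)%N then 1 else -1.

Definition sprod x y : R := \sum_i tau i * x i ord0 * y i ord0.

Definition Jinv J x : 'cV[R]_(k + l) := invmx (diag_mx J) *m x.

(* Phase space: pairs (q, Q). *)
Definition phase := ('cV[R]_(k + l) * 'cV[R]_(k + l))%type.

Definition Pstar J (c : R) : levelset phase (R * R)%type :=
  {| lev_dom := [set p : phase | sprod p.1 (Jinv J p.2) != 0];
     lev_map := fun p : phase => (sprod p.1 p.1, sprod p.2 p.2);
     lev_val := (c, c) |}.

(* sum_i tau_i J_i dQ_i /\ dq_i *)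
Definition Omega J (u v : phase) : R :=
  \sum_i tau i * J ord0 i *
    (u.2 i ord0 * v.1 i ord0 - v.2 i ord0 * u.1 i ord0).

Definition Phi_dom J : set phase :=
  [set p : phase | sprod (Jinv J (Jinv J p.2)) p.2 != 0].

Definition lambda J (p : phase) : R :=
  2 * sprod (Jinv J p.2) p.1 / sprod (Jinv J (Jinv J p.2)) p.2.

Definition Phi J (p : phase) : phase :=
  (p.2, lambda J p *: Jinv J p.2 - p.1).

End Heisenberg.

(* Main.v *)
(** Write x = Q, y = J q, r_s,i = 1 / (J_i^2 + s) and, with weights tau r_s,
    alpha = [x, x], beta = [x, y], gamma = [y, y] - c. The integrals are
    alpha * gamma - beta^2 for n - 1 distinct positive values of s: up to the signs
    tau they are values of the generating function of Uhlenbeck's integrals of the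
    Neumann system. Their gradient in y is annihilated by x, so on the constraint
    surface the Dirac bracket of two of them is their canonical bracket, which
    vanishes by the resolvent identity (t - s) r_s r_t = r_s - r_t. Invariance holds
    because on the surface the expression is symmetric in q and Q, while Phi turns
    (J q, Q) = (y, x) into (J Q', q') = (lambda x - y, x), which up to sign is a shear.

    Independence only uses the y-gradients, which form a matrix linear in q, unchanged
    when q moves along J^-1 Q, and having a Cauchy minor when q is a basis vector and
    no coordinate of Q vanishes. Near a given point one first perturbs Q to have no
    zero coordinate, then q in the direction of that basis vector, which makes this
    minor nonzero, and finally returns to the quadric along J^-1 Q, which is
    transversal to it exactly because the point lies in P_c^*. *)

Require Import Defs.
From HB Require Import structures.
From mathcomp Require Import all_boot all_order all_algebra.
From mathcomp Require Import perm ring lra.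
From mathcomp Require Import all_classical all_reals all_analysis.

Set Implicit Arguments.
Unset Strict Implicit.

Import Order.TTheory GRing.Theory Num.Theory.
Import numFieldNormedType.Exports.
Local Open Scope ring_scope.

(** * Smooth maps *)

Section Differentiable.
Context {R : realType} {V W : normedModType R}.

(** A first-order expansion involves only the germ at the point, so the differential of [f] serves
    as that of [g]. *)
Lemma near_eq_differentiable (f g : V -> W) x :
  (\near x, f x = g x) -> differentiable f x -> differentiable g x.
Proof.
move=> fg df; have fgx := nbhs_singleton fg.
have dg : g \o shift x = cst (g x) + 'd f x +o_ 0 id.
  apply/eqaddoP => e e0; have := diff_locally df => /eqaddoP /(_ e e0).
  have : \forall y \near 0, f (y + x) = g (y + x).
    by move: fg; rewrite (near_shift 0 x) subr0; apply: filterS => y /=.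
  apply: filterS2 => y /= fgy.
  by rewrite !fctE /= fgx -fgy; apply.
apply/diff_locallyP; rewrite (diff_unique (diff_continuous df) dg).
by split=> [|//]; exact: diff_continuous.
Qed.

Lemma scaler_is_bilinear :
  bilinear_for
    (GRing.Scale.Law.clone _ _ *:%R _) (GRing.Scale.Law.clone _ _ *:%R _)
    (@GRing.scale R W).
Proof.
split=> [u'|u] a x y /=; first by rewrite scalerDl scalerA.
by rewrite scalerDr !scalerA mulrC.
Qed.

HB.instance Definition _ := bilinear_isBilinear.Build R R W W _ _
  (@GRing.scale R W) scaler_is_bilinear.

Lemma is_diff_scale (f df : V -> R) (g dg : V -> W) x :
  is_diff x f df -> is_diff x g dg ->
  is_diff x (fun y => f y *: g y) (fun v => f x *: dg v + df v *: g x).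
Proof.
move=> dfx dgx; pose s (p : R * W) := p.1 *: p.2.
have ds : is_diff (f x, g x) s (fun q => f x *: q.2 + q.1 *: g x).
  apply: DiffDef; last by rewrite diff_bilin // => ?; exact: scale_continuous.
  by apply: differentiable_bilin => ?; exact: scale_continuous.
exact: (@is_diff_comp _ _ _ _ (fun y => (f y, g y)) (fun v => (df v, dg v)) s).
Qed.

End Differentiable.

Section Smooth.
Context {R : realType} {V : normedModType R}.
Implicit Types (U : set V) (m : nat).

(** As [U] is open, equality on [U] passes to derivatives. The rules below use this to replace a
    derivative by its explicit formula, known on [U] only. *)
Lemma eq_Ck (W : normedModType R) m U (f g : V -> W) :
  open U -> (forall x, U x -> f x = g x) -> Ck m U f -> Ck m U g.
Proof.
move=> oU; elim: m f g => [|m IH] f g fg /=.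
  move=> Cf x Ux; rewrite /prop_for /continuous_at -(fg x Ux).
  apply: cvg_trans (Cf x Ux); apply: near_eq_cvg.
  by apply: filterS (open_nbhs_nbhs (conj oU Ux)) => y /fg.
have nfg x : U x -> \near x, f x = g x.
  by move=> Ux; apply: filterS (open_nbhs_nbhs (conj oU Ux)) => y /fg.
case=> df Cf; split=> [x Ux|v];
  first exact: near_eq_differentiable (nfg x Ux) (df x Ux).
apply: (IH (fun x => 'D_v f x)) (Cf v) => x Ux.
exact/near_eq_derive/nfg.
Qed.

Lemma CkW (W : normedModType R) m U (f : V -> W) : Ck m.+1 U f -> Ck m U f.
Proof.
elim: m f => [|m IH] f; first by case=> df _ x /df /differentiable_continuous.
by case=> df Cf; split=> // v; apply: IH; apply: Cf.
Qed.

Lemma Ck_cst (W : normedModType R) m U (a : W) : Ck m U (cst a : V -> W).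
Proof.
elim: m a => [|m IH] a /=; first by move=> x _; exact: cst_continuous.
split=> // v; rewrite (_ : (fun x => _) = cst 0); first exact: IH.
by apply/funext => x; rewrite derive_cst.
Qed.

Lemma Ck_linear (W : normedModType R) m U (f : {linear V -> W}) :
  continuous f -> Ck m U f.
Proof.
move=> cf; case: m => [|m] /=; first by move=> x _; exact: cf.
split=> [x _|v]; first exact: linear_differentiable.
rewrite (_ : (fun x => _) = cst (f v)); first exact: Ck_cst.
apply/funext => x; rewrite deriveE; last exact: linear_differentiable.
by rewrite diff_lin.
Qed.

Lemma CkD (W : normedModType R) m U (f g : V -> W) : open U ->
  Ck m U f -> Ck m U g -> Ck m U (fun x => f x + g x).
Proof.
move=> oU; elim: m f g => [|m IH] f g /=.
  by move=> Cf Cg x Ux; apply: continuousD; [apply: Cf|apply: Cg].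
case=> df Cf [dg Cg]; split=> [x Ux|v].
  by apply: differentiableD; [apply: df|apply: dg].
apply: eq_Ck (IH _ _ (Cf v) (Cg v)) => // x Ux.
by rewrite -deriveD //; apply: diff_derivable; [exact: df|exact: dg].
Qed.

(** Each Leibniz term keeps one factor undifferentiated, hence the appeal to [CkW] before the
    induction hypothesis. *)
Lemma CkZ (W : normedModType R) m U (f : V -> R) (g : V -> W) : open U ->
  Ck m U f -> Ck m U g -> Ck m U (fun x => f x *: g x).
Proof.
move=> oU; elim: m f g => [|m IH] f g.
  by move=> Cf Cg x Ux; apply: continuousZ; [apply: Cf|apply: Cg].
move=> Cf1 Cg1; have Cf := CkW Cf1; have Cg := CkW Cg1.
case: Cf1 Cg1 => df Cf' [dg Cg'].
have dfg x : U x ->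
    is_diff x (fun x => f x *: g x)
      (fun v => f x *: 'd g x v + 'd f x v *: g x).
  by move=> Ux; apply: is_diff_scale; apply: differentiableP;
    [exact: df|exact: dg].
split=> [x /dfg [] //|v].
apply: eq_Ck (CkD oU (IH _ _ Cf (Cg' v)) (IH _ _ (Cf' v) Cg)) => // x Ux.
have [d e] := dfg x Ux.
by rewrite (deriveE v d) e (deriveE v (df x Ux)) (deriveE v (dg x Ux)).
Qed.

(** The derivative of 1/f contains 1/f itself, which the induction hypothesis provides one order
    lower. *)
Lemma CkV m U (f : V -> R) : open U -> (forall x, U x -> f x != 0) ->
  Ck m U f -> Ck m U (fun x => (f x)^-1).
Proof.
move=> oU f0; elim: m => [|m IH].
  by move=> Cf x Ux; apply: continuousV; [exact: f0|exact: Cf].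
move=> Cf1; have /IH Cf := CkW Cf1; case: Cf1 => df Cf'.
split=> [x Ux|v]; first by apply: differentiableV; [exact: df|exact: f0].
have C1 := CkZ oU (Ck_cst m U (-1 : R)) (CkZ oU (CkZ oU Cf Cf) (Cf' v)).
apply: eq_Ck C1 => // x Ux.
rewrite deriveV ?f0 //; last exact/diff_derivable/df.
by rewrite /cst scaleN1r /GRing.scale/= expr2 invfM mulNr.
Qed.

Lemma Ck_sum (I : Type) (r : seq I) (W : normedModType R) m U
  (f : I -> V -> W) :
  open U -> (forall i, Ck m U (f i)) -> Ck m U (fun x => \sum_(i <- r) f i x).
Proof.
move=> oU Cf; elim: r => [|i r IH].
  rewrite (_ : (fun _ => _) = cst 0); first exact: Ck_cst.
  by apply/funext => x; rewrite big_nil.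
rewrite (_ : (fun _ => _) = fun x => f i x + \sum_(i <- r) f i x).
  exact: CkD.
by apply/funext => x; rewrite big_cons.
Qed.

End Smooth.

(** * Weighted bilinear forms *)

Lemma fst_continuous (U V : topologicalType) : continuous (@fst U V).
Proof. by move=> p; exact: cvg_fst. Qed.

Lemma snd_continuous (U V : topologicalType) : continuous (@snd U V).
Proof. by move=> p; exact: cvg_snd. Qed.

Section WeightedProduct.
Context {R : realType} {n : nat}.
Implicit Types (w : 'I_n -> R) (x y z : 'cV[R]_n) (a : R).

(** One family of diagonal forms, with weights of any sign, covers the scalar product, the pairing
    in [Omega] and the forms weighted by resolvents. *)
Definition wdot w x y : R := \sum_i w i * x i ord0 * y i ord0.

Lemma wdotC w x y : wdot w x y = wdot w y x.
Proof. by apply: eq_bigr => i _; rewrite mulrAC. Qed.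

Lemma wdotPl w a x y z : wdot w (a *: x + y) z = a * wdot w x z + wdot w y z.
Proof.
rewrite /wdot mulr_sumr -big_split; apply: eq_bigr => i _ /=.
by rewrite !mxE; ring.
Qed.

Lemma wdotPr w a x y z : wdot w z (a *: x + y) = a * wdot w z x + wdot w z y.
Proof. by rewrite !(wdotC w z) wdotPl. Qed.

Lemma wdot_is_bilinear w :
  bilinear_for
    (GRing.Scale.Law.clone _ _ *:%R _) (GRing.Scale.Law.clone _ _ *:%R _)
    (wdot w : _ -> _ -> R^o).
Proof. by split=> [u|u] a x y /=; rewrite (wdotPl, wdotPr). Qed.

HB.instance Definition _ w := bilinear_isBilinear.Build R
  'cV[R]_n 'cV[R]_n R^o _ _ (wdot w) (wdot_is_bilinear w).

Lemma wdotDl w x y z : wdot w (x + y) z = wdot w x z + wdot w y z.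
Proof. exact: linearDl. Qed.

Lemma wdotDr w x y z : wdot w z (x + y) = wdot w z x + wdot w z y.
Proof. exact: linearDr. Qed.

Lemma wdotZl w a x z : wdot w (a *: x) z = a * wdot w x z.
Proof. exact: linearZl_LR. Qed.

Lemma wdotZr w a x z : wdot w z (a *: x) = a * wdot w z x.
Proof. exact: linearZr_LR. Qed.

Lemma wdotBl w x y z : wdot w (x - y) z = wdot w x z - wdot w y z.
Proof. exact: linearBl. Qed.

Lemma wdotBr w x y z : wdot w z (x - y) = wdot w z x - wdot w z y.
Proof. exact: linearBr. Qed.

Lemma wdot_delta w x i : wdot w x (delta_mx i ord0) = w i * x i ord0.
Proof.
rewrite /wdot (bigD1 i) //= big1 => [|j ji]; rewrite !mxE ?eqxx ?mulr1 ?addr0 //.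
by rewrite (negPf ji) mulr0.
Qed.

Lemma Ck_coord (V : normedModType R) (A : {linear V -> 'cV[R]_n}) m U i :
  continuous A -> Ck m U (fun p => A p i ord0 : R).
Proof.
move=> cA; have lin : linear (fun p => A p i ord0 : R^o).
  by move=> a u v; rewrite linearP !mxE.
pose LM := GRing.isLinear.Build _ _ _ _ _ lin.
pose L : {linear V -> R^o} := HB.pack (fun p => A p i ord0 : R^o) LM.
apply: (@Ck_linear _ _ _ m U L) => p.
apply: (@continuous_comp _ _ _ A (fun M : 'cV[R]_n => M i ord0)).
  exact: cA.
exact: coord_continuous.
Qed.

Lemma Ck_wdot (V : normedModType R) w (A B : {linear V -> 'cV[R]_n}) m U :
  continuous A -> continuous B -> open U ->
  Ck m U (fun p => wdot w (A p) (B p) : R).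
Proof.
move=> cA cB oU; apply: Ck_sum => // i.
apply: (CkZ oU) (Ck_coord _ _ _ cB).
exact: (CkZ oU (Ck_cst m U (w i)) (Ck_coord _ _ _ cA)).
Qed.

Lemma wdot_continuous (V : normedModType R) w (A B : {linear V -> 'cV[R]_n}) :
  continuous A -> continuous B -> continuous (fun p => wdot w (A p) (B p) : R).
Proof. by move=> cA cB p; exact: (@Ck_wdot _ _ _ _ 0 setT cA cB openT). Qed.

Lemma wdotr_continuous w x : continuous (wdot w x).
Proof.
have C : Ck 0 setT (fun y => wdot w x y : R).
  apply: (Ck_sum _ openT) => i; apply: (CkZ openT (Ck_cst 0 setT (w i * x i ord0))).
  by apply: (@Ck_coord _ idfun) => y; exact: cvg_id.
by move=> y; exact: C.
Qed.

Lemma is_diff_wdot (V : normedModType R) w (A B : {linear V -> 'cV[R]_n}) p :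
  continuous A -> continuous B ->
  is_diff p (fun p => wdot w (A p) (B p) : R)
            (fun v => wdot w (A v) (B p) + wdot w (A p) (B v)).
Proof.
move=> cA cB; have [d _] := Ck_wdot w 1 cA cB (@openT V).
apply: DiffDef; first exact: d.
have cw : continuous (fun q : 'cV[R]_n * 'cV[R]_n => wdot w q.1 q.2 : R^o).
  have [dw _] := @Ck_wdot _ w fst snd 1 _
    (@fst_continuous _ _) (@snd_continuous _ _) openT.
  by move=> q; apply: differentiable_continuous; exact: dw.
have dA : is_diff p A A.
  by apply: DiffDef; [exact: linear_differentiable|exact: diff_lin].
have dB : is_diff p B B.
  by apply: DiffDef; [exact: linear_differentiable|exact: diff_lin].
have dAB := is_diff_pair dA dB.
have dW : is_diff (A p, B p)
    (fun q : 'cV[R]_n * 'cV[R]_n => wdot w q.1 q.2 : R^o)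
    (fun q => wdot w (A p) q.2 + wdot w q.1 (B p)).
  by apply: DiffDef; [exact: differentiable_bilin|exact: diff_bilin].
have [_ e] := is_diff_comp dAB dW.
by rewrite [LHS]e; apply/funext => v /=; rewrite addrC.
Qed.

End WeightedProduct.

Section Coordinatewise.
Context {R : realType} {n : nat}.
Implicit Types (w u : 'I_n -> R) (x y : 'cV[R]_n).

Lemma cvg_col (T : Type) (F : set_system T) (f : T -> 'cV[R]_n) x :
  Filter F -> (forall i, (f t i ord0 @[t --> F] --> x i ord0)%classic) ->
  (f t @[t --> F] --> x)%classic.
Proof.
move=> FF fx A [P nP PA].
have : \forall t \near F, forall i, P i ord0 (f t i ord0).
  by apply: filter_forall => i; exact: (fx i _ (nP i ord0)).
by apply: filterS => t Pt; apply: PA => i j; rewrite (ord1 j).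
Qed.

(** Written by coordinates so that [wdot] can absorb it into its weights. *)
Definition diagmul u x : 'cV[R]_n := \col_i (u i * x i ord0).

Lemma diagmul_is_linear u : linear (diagmul u).
Proof. by move=> a x y; apply/matrixP => i j; rewrite !mxE; ring. Qed.

HB.instance Definition _ u := GRing.isLinear.Build R
  'cV[R]_n 'cV[R]_n _ (diagmul u) (diagmul_is_linear u).

Lemma diagmul_continuous u : continuous (diagmul u).
Proof.
move=> x; apply: (@cvg_col _ (nbhs x)) => i; rewrite mxE.
under eq_cvg do rewrite mxE.
apply: (@continuous_comp _ _ _ (fun x : 'cV[R]_n => x i ord0) ( *%R (u i))).
  exact: coord_continuous.
exact: mulrl_continuous.
Qed.

Lemma eq_wdot w w' x y : w =1 w' -> wdot w x y = wdot w' x y.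
Proof. by move=> e; apply: eq_bigr => i _; rewrite e. Qed.

Lemma wdot_diagmul w u x y :
  wdot w x (diagmul u y) = wdot (fun i => w i * u i) x y.
Proof. by apply: eq_bigr => i _; rewrite mxE; ring. Qed.

Lemma wdot_diagmull w u x y :
  wdot w (diagmul u x) y = wdot (fun i => w i * u i) x y.
Proof. by rewrite wdotC wdot_diagmul wdotC. Qed.

Lemma wdot_eq0 w x : (forall i, w i != 0) -> (forall y, wdot w x y = 0) -> x = 0.
Proof.
move=> w0 x0; apply/colP => i; rewrite mxE; apply/eqP.
by have /eqP := x0 (delta_mx i ord0); rewrite wdot_delta mulf_eq0 (negPf (w0 i)).
Qed.

End Coordinatewise.

(** * The phase space *)

Section HeisenbergModel.
Context {R : realType} {k l : nat}.
Variables (J : 'rV[R]_(k + l)) (c : R).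
Hypothesis J0 : forall i, J ord0 i != 0.

Local Notation n := (k + l)%N.
Local Notation V := (@phase R k l).
Local Notation K := (diagmul (fun i => (J ord0 i)^-1)).
Local Notation tau := (@tau R k l).
Local Notation P := (points (Pstar J c)).
Local Notation T := (tangent (Pstar J c)).
Implicit Types (x y : 'cV[R]_n) (p u v : V).

Definition tauJ (i : 'I_n) : R := tau i * J ord0 i.

Lemma tau_neq0 i : tau i != 0.
Proof. by rewrite /tau; case: ifP; rewrite ?oppr_eq0 oner_eq0. Qed.

Lemma tauJ_neq0 i : tauJ i != 0.
Proof. by rewrite mulf_neq0 ?tau_neq0. Qed.

Lemma JinvE x : Jinv J x = K x.
Proof.
have uJ : diag_mx J \in unitmx.
  by rewrite unitmxE det_diag unitfE; apply/prodf_neq0 => i _.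
apply: (can_inj (mulKmx uJ)); rewrite mulKVmx //.
apply/colP => i; rewrite !mxE (bigD1 i) //= big1 => [|j ji]; rewrite !mxE.
  by rewrite eqxx mulr1n addr0 mulVKf.
by rewrite eq_sym (negPf ji) mulr0n mul0r.
Qed.

Lemma sprodE x y : sprod x y = wdot tau x y.
Proof. by []. Qed.

Lemma OmegaE u v : Omega J u v = wdot tauJ u.2 v.1 - wdot tauJ v.2 u.1.
Proof.
rewrite /wdot -sumrB; apply: eq_bigr => i _; rewrite /tauJ; ring.
Qed.

(** The factor J of [Omega] cancels J^-1, which turns symplectic pairings with [K y] into the scalar
    products that define tangency. *)
Lemma wdot_tauJK x y : wdot tauJ x (K y) = wdot tau x y.
Proof. by rewrite wdot_diagmul; apply: eq_wdot => i; rewrite /tauJ mulfK. Qed.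

Lemma wdot_KC x y : wdot tau (K x) y = wdot tau x (K y).
Proof. by rewrite wdot_diagmul wdot_diagmull. Qed.

Lemma is_diff_wdot11 w p : is_diff p (fun p : V => wdot w p.1 p.1 : R)
  (fun v => 2 * wdot w p.1 v.1).
Proof.
have d := is_diff_wdot w p (@fst_continuous _ _) (@fst_continuous _ _).
by apply: is_diff_eq d _; apply/funext => v /=; rewrite (wdotC w v.1); ring.
Qed.

Lemma is_diff_wdot22 w p : is_diff p (fun p : V => wdot w p.2 p.2 : R)
  (fun v => 2 * wdot w p.2 v.2).
Proof.
have d := is_diff_wdot w p (@snd_continuous _ _) (@snd_continuous _ _).
by apply: is_diff_eq d _; apply/funext => v /=; rewrite (wdotC w v.2); ring.
Qed.

Lemma is_diff_wdot21 w p : is_diff p (fun p : V => wdot w p.2 p.1 : R)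
  (fun v => wdot w p.1 v.2 + wdot w p.2 v.1).
Proof.
have d := is_diff_wdot w p (@snd_continuous _ _) (@fst_continuous _ _).
by apply: is_diff_eq d _; apply/funext => v /=; rewrite (wdotC w v.2).
Qed.

Lemma diff_constraint p v : 'd (lev_map (Pstar J c)) p v =
  (2 * wdot tau p.1 v.1, 2 * wdot tau p.2 v.2).
Proof.
have [_ /= e] := is_diff_pair (is_diff_wdot11 tau p) (is_diff_wdot22 tau p).
by rewrite [LHS](congr1 (@^~ v) e).
Qed.

Lemma tangentP p v : T p v <-> wdot tau p.1 v.1 = 0 /\ wdot tau p.2 v.2 = 0.
Proof.
rewrite /tangent /= diff_constraint; split=> [[/eqP + /eqP]|[-> ->]].
  by rewrite !mulf_eq0 !pnatr_eq0 /= => /eqP -> /eqP ->.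
by rewrite mulr0.
Qed.

Lemma pointsP p : P p <->
  [/\ wdot tau p.1 (K p.2) != 0, wdot tau p.1 p.1 = c & wdot tau p.2 p.2 = c].
Proof.
rewrite /points /preimage /= JinvE sprodE.
by split=> [[? [? ?]]|[? e1 e2]]; [split|split=> //; congr pair].
Qed.

Lemma Pstar_regular p (w : R * R) :
  P p -> exists v, 'd (lev_map (Pstar J c)) p v = w.
Proof.
move=> /pointsP[h _ _]; set h0 := wdot _ _ _ in h.
(* J^-1 Q and J^-1 q are transversal to the two quadrics, both through the nonzero number <q, J^-1
   Q>. *)
exists ((w.1 / (2 * h0)) *: K p.2, (w.2 / (2 * h0)) *: K p.1).
rewrite diff_constraint /= !wdotZr -(wdot_KC p.2) (wdotC tau (K _)) -/h0.
by case: w => w1 w2 /=; congr pair; field.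
Qed.

Lemma tangent_shift1 p y : wdot tau p.1 (K p.2) != 0 ->
  T p (y - (wdot tau p.1 y / wdot tau p.1 (K p.2)) *: K p.2, 0).
Proof.
by move=> h; apply/tangentP; rewrite /= wdotBr wdotZr divfK // subrr linear0r.
Qed.

Lemma tangent_shift2 p y : wdot tau p.1 (K p.2) != 0 ->
  T p (0, y - (wdot tau p.2 y / wdot tau p.1 (K p.2)) *: K p.1).
Proof.
move=> h; apply/tangentP; rewrite /= wdotBr wdotZr -(wdot_KC p.2).
by rewrite (wdotC tau (K _)) divfK // subrr linear0r.
Qed.

(** The test vectors are arbitrary vectors corrected along J^-1 Q or J^-1 q. The correction
    contributes a multiple of <u_2, Q> or <u_1, q>, zero by tangency of u, so each component of u is
    [tauJ]-orthogonal to everything. *)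
Lemma Omega_nondegenerate p u : P p -> T p u ->
  (forall v, T p v -> Omega J u v = 0) -> u = 0.
Proof.
move=> /pointsP[h _ _] /tangentP[u1 u2] u0.
have e2 : u.2 = 0.
  apply: (wdot_eq0 tauJ_neq0) => y.
  have := u0 _ (tangent_shift1 y h).
  rewrite OmegaE /= linear0l subr0 wdotBr wdotZr wdot_tauJK.
  by rewrite (wdotC _ u.2 p.2) u2 mulr0 subr0.
have e1 : u.1 = 0.
  apply: (wdot_eq0 tauJ_neq0) => y.
  have := u0 _ (tangent_shift2 y h).
  rewrite OmegaE /= linear0r sub0r => /eqP; rewrite oppr_eq0 => /eqP.
  by rewrite wdotC wdotBr wdotZr wdot_tauJK (wdotC _ u.1 p.1) u1 mulr0 subr0.
by rewrite [u]surjective_pairing e1 e2.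
Qed.

(** Nondegeneracy leaves at most one Hamiltonian vector, so the choice made by [get] equals any
    explicit candidate. *)
Lemma ham_vecE (g : V -> R) p X : P p -> T p X ->
  (forall v, T p v -> Omega J X v = 'd g p v) ->
  ham_vec (Pstar J c) (Omega J) g p = X.
Proof.
move=> Pp TX hX.
have [TY hY] :
    [set Y | T p Y /\ forall v, T p v -> Omega J Y v = 'd g p v]%classic
    (ham_vec (Pstar J c) (Omega J) g p).
  by apply: getPex; exists X.
apply/eqP; rewrite -subr_eq0; apply/eqP/(Omega_nondegenerate Pp).
  move: TX TY => /tangentP[a b] /tangentP[a' b']; apply/tangentP.
  by rewrite /= !wdotBr a b a' b' subrr.
move=> v Tv; rewrite OmegaE /= wdotBl wdotBr; have := hX v Tv.
by rewrite -(hY v Tv) !OmegaE => /eqP; rewrite -subr_eq0 => /eqP; lra.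
Qed.

Lemma Pstar_smooth U : open U -> smooth_on U (lev_map (Pstar J c)).
Proof.
move=> oU m.
have C1 := Ck_wdot tau m (@fst_continuous _ _) (@fst_continuous _ _) oU.
have C2 := Ck_wdot tau m (@snd_continuous _ _) (@snd_continuous _ _) oU.
have C3 := CkD oU (CkZ oU C1 (Ck_cst m U ((1, 0) : R * R)))
                  (CkZ oU C2 (Ck_cst m U ((0, 1) : R * R))).
apply: eq_Ck C3 => // p _ /=.
by congr pair; rewrite /= /GRing.scale /= mulr1 mulr0 ?addr0 ?add0r.
Qed.

Lemma has_dim_ker r (M : 'M[R]_(n + n, r)) :
  has_dim [set v : V | row_mx v.1^T v.2^T *m M = 0]%classic (n + n - \rank M)%N.
Proof.
rewrite -mxrank_ker; set N := row_base (kermx M).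
pose f (a : 'rV[R]_(n + n)) : V := ((lsubmx a)^T, (rsubmx a)^T).
have lin : linear f.
  by move=> a x y; congr pair; rewrite /= linearP /= linearP.
pose fM := GRing.isLinear.Build _ _ _ _ _ lin.
pose fL : {linear 'rV[R]_(n + n) -> V} := HB.pack f fM.
exists (fun i => f (row i N)) => comb.
have combE a : comb a = f (a *m N).
  rewrite /comb mulmx_sum_row -[RHS]/(fL _) (linear_sum fL).
  by apply: eq_bigr => i _; rewrite (linearZ_LR fL).
have fK (a : 'rV_(n + n)) : row_mx (f a).1^T (f a).2^T = a.
  by rewrite /= !trmxK hsubmxK.
split; last first.
  move=> a b; rewrite !combE => /(congr1 (fun v : V => row_mx v.1^T v.2^T)).
  by rewrite !fK; exact/row_free_inj/row_base_free.
apply/seteqP; split=> [_ [a _ <-]|v /= v0].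
  rewrite combE /= fK; apply/sub_kermxP.
  by rewrite (submx_trans (submxMl _ _)) // eq_row_base.
have : (row_mx v.1^T v.2^T <= N)%MS by rewrite eq_row_base; exact/sub_kermxP.
move=> /submxP[a ea]; exists a => //; rewrite combE -ea /f row_mxKl row_mxKr.
by rewrite !trmxK -surjective_pairing.
Qed.

Lemma tangent_dim p : P p -> has_dim (T p) (2 * n - 2)%N.
Proof.
move=> /pointsP[h _ _].
(* The columns are the constraint gradients up to the factor 2, both nonzero because <q, J^-1 Q>
   is. *)
pose M : 'M[R]_(n + n, 1 + 1) :=
  block_mx (diagmul tau p.1) 0 0 (diagmul tau p.2).
have rank1 x y : wdot tau x y != 0 -> \rank (diagmul tau x) = 1%N.
  move=> xy; rewrite -mxrank_tr rank_rV -[0]trmx0 (inj_eq trmx_inj).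
  case: eqP => // /colP x0; case/eqP: xy; apply: big1 => i _.
  by have := x0 i; rewrite !mxE => ->; rewrite mul0r.
have rM : \rank M = 2%N.
  rewrite rank_diag_block_mx (rank1 _ _ h) (rank1 _ (K p.1)) //.
  by rewrite -wdot_KC wdotC.
have -> : T p = [set v : V | row_mx v.1^T v.2^T *m M = 0]%classic.
  have dotE x y : x^T *m diagmul tau y = (wdot tau y x)%:M.
    apply/rowP => i; rewrite !mxE (ord1 i) eqxx mulr1n.
    by apply: eq_bigr => j _; rewrite !mxE mulrC.
  apply/seteqP; split=> v.
    move=> /tangentP[v1 v2] /=.
    by rewrite mul_row_block !mulmx0 addr0 add0r !dotE v1 v2 raddf0 row_mx0.
  rewrite /= mul_row_block !mulmx0 addr0 add0r !dotE -[0]row_mx0.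
  move=> /eq_row_mx[/matrixP/(_ ord0 ord0) + /matrixP/(_ ord0 ord0)].
  by rewrite !mxE eqxx !mulr1n => ? ?; apply/tangentP.
by rewrite mul2n -addnn -rM; exact: has_dim_ker.
Qed.

Lemma Pstar_dom_open : open (lev_dom (Pstar J c)).
Proof.
have -> : lev_dom (Pstar J c) =
    ((fun p : V => wdot (fun i => tau i * (J ord0 i)^-1) p.1 p.2) @^-1`
      [set x : R | x != 0])%classic.
  by apply/seteqP; split=> p; rewrite /= JinvE sprodE wdot_diagmul.
apply: open_comp => [p _|]; last exact: open_neq.
exact: (wdot_continuous (@fst_continuous _ _) (@snd_continuous _ _)).
Qed.

Lemma Pstar_symplectic : symplectic_manifold (Pstar J c) (Omega J) (2 * n - 2)%N.
Proof.
split.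
- split.
  + exact: Pstar_dom_open.
  + exact/Pstar_smooth/Pstar_dom_open.
  + by move=> p Pp w; exact: Pstar_regular.
  + exact: tangent_dim.
- by move=> a u v w; rewrite !OmegaE /= wdotPl wdotPr; ring.
- by move=> a u v w; rewrite !OmegaE /= wdotPl wdotPr; ring.
- by move=> v; rewrite OmegaE subrr.
- by move=> p Pp u Tu; exact: Omega_nondegenerate.
Qed.

End HeisenbergModel.

(** * The Heisenberg map *)

Section Dynamics.
Context {R : realType} {k l : nat}.
Variables (J : 'rV[R]_(k + l)) (c : R).
Hypothesis J0 : forall i, J ord0 i != 0.

Local Notation n := (k + l)%N.
Local Notation V := (@phase R k l).
Local Notation K := (diagmul (fun i => (J ord0 i)^-1)).
Local Notation tau := (@tau R k l).
Local Notation P := (points (Pstar J c)).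
Local Notation T := (tangent (Pstar J c)).
Implicit Types (x y : 'cV[R]_n) (p u v : V).

Local Notation lam := (lambda J).
Local Notation D := (Phi_dom J).

Lemma Phi_domE : D =
  ((fun p : V => wdot (fun i => tau i * (J ord0 i)^-1 * (J ord0 i)^-1) p.2 p.2)
    @^-1` [set x : R | x != 0])%classic.
Proof.
have e p : sprod (Jinv J (Jinv J p.2)) p.2 =
    wdot (fun i => tau i * (J ord0 i)^-1 * (J ord0 i)^-1) p.2 p.2.
  by rewrite !JinvE // sprodE wdotC !wdot_diagmul.
by apply/seteqP; split=> p; rewrite /Phi_dom /= e.
Qed.

Lemma lambdaE p :
  lam p = 2 * wdot tau p.1 (K p.2) / wdot tau (K p.2) (K p.2).
Proof.
by rewrite /lambda !JinvE // !sprodE (wdotC _ _ p.1) (wdot_KC _ (K _)).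
Qed.

Lemma Phi_domP p : D p <-> wdot tau (K p.2) (K p.2) != 0.
Proof. by rewrite /Phi_dom /= !JinvE // sprodE wdot_KC. Qed.

Lemma PhiE p : Phi J p = (p.2, lam p *: K p.2 - p.1).
Proof. by rewrite /Phi JinvE. Qed.

Lemma Phi_dom_open : open D.
Proof.
rewrite Phi_domE; apply: open_comp => [p _|]; last exact: open_neq.
exact: (wdot_continuous (@snd_continuous _ _) (@snd_continuous _ _)).
Qed.

(** By the choice of [lambda], the new second component is minus the reflection of q in the
    hyperplane orthogonal to J^-1 Q. This preserves both <q, q> and the pairing with J^-1 Q. *)
Lemma Phi_points p : P p -> D p -> P (Phi J p).
Proof.
move=> /pointsP[// |h h1 h2] /Phi_domP d; apply/pointsP => //.
have e : wdot tau p.2 (K (lam p *: K p.2 - p.1)) = wdot tau p.1 (K p.2).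
  rewrite -wdot_KC wdotBr wdotZr (wdotC _ _ p.1) lambdaE divfK //; ring.
rewrite PhiE /=; split=> //; first by rewrite e.
rewrite !wdotBl !wdotBr !wdotZl !wdotZr h1 (wdotC tau _ p.1) lambdaE.
by field.
Qed.

(** [Phi] is a linear map plus [lambda] times another one, which reduces smoothness and the
    differential to those of a scalar function. *)
Let L1 (p : V) : V := (p.2, - p.1).
Let L2 (p : V) : V := (0, K p.2).

Let L1_is_linear : linear L1.
Proof. by move=> a u v; congr pair; rewrite /= opprD scalerN. Qed.

Let L2_is_linear : linear L2.
Proof. by move=> a u v; congr pair; rewrite /= ?linearP // scaler0 addr0. Qed.

HB.instance Definition _ := GRing.isLinear.Build R V V _ L1 L1_is_linear.
HB.instance Definition _ := GRing.isLinear.Build R V V _ L2 L2_is_linear.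

Let L1_continuous : continuous L1.
Proof.
move=> p; have c1 : {for p, continuous (fun p : V => - p.1)}.
  by apply: continuousN; exact: fst_continuous.
exact: (cvg_pair (@snd_continuous _ _ p) c1).
Qed.

Let L2_continuous : continuous L2.
Proof.
move=> p; have cK : {for p, continuous (fun p : V => K p.2)}.
  apply: (@continuous_comp _ _ _ snd (diagmul _)); first exact: snd_continuous.
  exact: diagmul_continuous.
exact: (cvg_pair (cvg_cst _) cK).
Qed.

Let PhiL : Phi J = fun p => L1 p + lam p *: L2 p.
Proof.
apply/funext => p; rewrite PhiE; congr pair; rewrite /= ?scaler0 ?addr0 //.
by rewrite addrC.
Qed.

Lemma lambda_smooth : smooth_on D lam.
Proof.
move=> m; have oD := Phi_dom_open.
have C1 := Ck_wdot (fun i => tau i * (J ord0 i)^-1) m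
  (@fst_continuous _ _) (@snd_continuous _ _) oD.
have C2 := Ck_wdot (fun i => tau i * (J ord0 i)^-1 * (J ord0 i)^-1) m
  (@snd_continuous _ _) (@snd_continuous _ _) oD.
have d0 p : D p ->
    wdot (fun i => tau i * (J ord0 i)^-1 * (J ord0 i)^-1) p.2 p.2 != 0.
  by rewrite Phi_domE.
have C3 := CkZ oD (CkZ oD (Ck_cst m D (2 : R)) C1) (CkV oD d0 C2).
apply: eq_Ck C3 => // p _ /=.
by rewrite lambdaE wdot_diagmul wdot_KC wdotC !wdot_diagmul.
Qed.

Lemma Phi_smooth : smooth_on D (Phi J).
Proof.
move=> m; have oD := Phi_dom_open; rewrite PhiL; apply: CkD => //.
  exact: (@Ck_linear _ _ _ m D L1 L1_continuous).
by apply: CkZ => //; [exact: lambda_smooth|exact: (@Ck_linear _ _ _ m D L2)].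
Qed.

Lemma diff_Phi p v : D p -> 'd (Phi J) p v =
  (v.2, lam p *: K v.2 + 'd lam p v *: K p.2 - v.1).
Proof.
move=> Dp; have [dl _] := lambda_smooth 1.
have d1 : is_diff p L1 L1.
  by apply: DiffDef; [exact: linear_differentiable|exact: diff_lin].
have d2 : is_diff p L2 L2.
  by apply: DiffDef; [exact: linear_differentiable|exact: diff_lin].
have [_ e] := is_diffD d1 (is_diff_scale (differentiableP (dl p Dp)) d2).
rewrite PhiL [LHS](congr1 (@^~ v) e); congr pair => /=.
  by rewrite !scaler0 !addr0.
by rewrite addrC.
Qed.

(** The differential of [lambda] need not be computed: it multiplies <Q, u_2> or <Q, v_2>, zero on
    tangent vectors. The two terms in [lambda] itself cancel by symmetry. *)
Lemma Phi_symplectic p u v : D p -> T p u -> T p v ->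
  Omega J ('d (Phi J) p u) ('d (Phi J) p v) = Omega J u v.
Proof.
move=> Dp /tangentP[_ u2] /tangentP[_ v2]; rewrite !diff_Phi // !OmegaE /=.
rewrite !wdotBl !wdotDl !wdotZl !(wdotC _ (K _)) !wdot_tauJK //.
rewrite (wdotC tau v.2 p.2) (wdotC tau u.2 p.2) u2 v2 (wdotC tau v.2) .
rewrite (wdotC _ v.1) (wdotC _ u.1); ring.
Qed.

End Dynamics.

(** * Integrals in involution *)

Section Integrals.
Context {R : realType} {k l : nat}.
Variables (J : 'rV[R]_(k + l)) (c : R).
Hypothesis J0 : forall i, J ord0 i != 0.

Local Notation n := (k + l)%N.
Local Notation V := (@phase R k l).
Local Notation K := (diagmul (fun i => (J ord0 i)^-1)).
Local Notation tau := (@tau R k l).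
Local Notation P := (points (Pstar J c)).
Local Notation T := (tangent (Pstar J c)).
Local Notation D := (Phi_dom J).
Implicit Types (x y : 'cV[R]_n) (p u v : V) (s t : R).

(** Diagonal of the resolvent of J^2 at -s. Points store q rather than y = J q, so each q in a
    product brings a factor J into the weight. *)
Definition res s (i : 'I_n) : R := (J ord0 i ^+ 2 + s)^-1.
Definition resJ s (i : 'I_n) : R := res s i * J ord0 i.

Definition alpha s p : R := wdot (fun i => tau i * res s i) p.2 p.2.
Definition beta s p : R := wdot (fun i => tau i * resJ s i) p.2 p.1.
Definition gamma s p : R :=
  wdot (fun i => tau i * resJ s i * J ord0 i) p.1 p.1 - c.

Definition uhlenbeck s p : R := alpha s p * gamma s p - beta s p ^+ 2.

(* Half the gradients of [uhlenbeck s] in [y] and in [x]. *)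
Definition grady s p : 'cV[R]_n :=
  alpha s p *: diagmul (resJ s) p.1 - beta s p *: diagmul (res s) p.2.
Definition gradx s p : 'cV[R]_n :=
  gamma s p *: diagmul (res s) p.2 - beta s p *: diagmul (resJ s) p.1.

Lemma uhlenbeck_smooth s U : open U -> smooth_on U (uhlenbeck s).
Proof.
move=> oU m.
have Ca : Ck m U (alpha s).
  exact: Ck_wdot (@snd_continuous _ _) (@snd_continuous _ _) oU.
have Cb : Ck m U (beta s).
  exact: Ck_wdot (@snd_continuous _ _) (@fst_continuous _ _) oU.
have Cg : Ck m U (gamma s).
  apply: (CkD oU _ (Ck_cst m U (- c))).
  exact: Ck_wdot (@fst_continuous _ _) (@fst_continuous _ _) oU.
have C := CkD oU (CkZ oU Ca Cg) (CkZ oU (Ck_cst m U (-1 : R)) (CkZ oU Cb Cb)).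
by apply: eq_Ck C => // p _; rewrite /uhlenbeck /GRing.scale /= mulN1r expr2.
Qed.

(** The weight [tauJ] of the second term accounts for dy = J dq. *)
Lemma diff_uhlenbeck s p v : 'd (uhlenbeck s) p v =
  2 * (wdot tau (gradx s p) v.2 + wdot (tauJ J) (grady s p) v.1).
Proof.
have da := is_diff_wdot22 (fun i => tau i * res s i) p.
have db := is_diff_wdot21 (fun i => tau i * resJ s i) p.
have dg := is_diff_wdot11 (fun i => tau i * resJ s i * J ord0 i) p.
have dc : is_diff p (gamma s)
    (fun v => 2 * wdot (fun i => tau i * resJ s i * J ord0 i) p.1 v.1).
  by apply: is_diff_eq (is_diffB dg (is_diff_cst c p)) _; exact: subr0.
have [_ e] := is_diffB (is_diff_scale da dc) (is_diff_scale db db).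
have -> : uhlenbeck s =
    (fun u => alpha s u *: gamma s u) - (fun u => beta s u *: beta s u).
  by apply/funext.
rewrite [LHS](congr1 (@^~ v) e) /= !fctE /= /gradx /grady.
rewrite !wdotBl !wdotZl !wdot_diagmull -/(alpha s p) -/(beta s p) -/(gamma s p).
rewrite /GRing.scale /=.
rewrite (@eq_wdot _ _ (fun i => tauJ J i * resJ s i)
  (fun i => tau i * resJ s i * J ord0 i)); last first.
  by move=> i; rewrite /tauJ; ring.
rewrite (@eq_wdot _ _ (fun i => tauJ J i * res s i)
  (fun i => tau i * resJ s i)); last first.
  by move=> i; rewrite /tauJ /resJ; ring.
ring.
Qed.

(** Infinitesimal form of the invariance of [uhlenbeck] under the shears y -> y + t x. *)
Lemma sprod_grady s p : wdot tau (grady s p) p.2 = 0.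
Proof.
rewrite /grady wdotBl !wdotZl !wdot_diagmull (wdotC _ p.1).
rewrite -/(beta s p) -/(alpha s p).
by rewrite mulrC subrr.
Qed.

(* On the constraint surface the roles of [q] and [Q] can be exchanged, because
   there [gamma s p = - s * wdot (tau r) q q]. *)
Lemma uhlenbeck_swap s p : (forall i, J ord0 i ^+ 2 + s != 0) ->
  P p -> uhlenbeck s p = wdot (fun i => tau i * res s i) p.1 p.1 *
    (wdot (fun i => tau i * resJ s i * J ord0 i) p.2 p.2 - c) - beta s p ^+ 2.
Proof.
move=> s0 /pointsP[// |_ e1 e2].
have gE x : wdot tau x x = c ->
    wdot (fun i => tau i * resJ s i * J ord0 i) x x - c =
    - s * wdot (fun i => tau i * res s i) x x.
  move=> <-; rewrite /wdot mulr_sumr -sumrB; apply: eq_bigr => i _.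
  by rewrite /resJ /res; field; rewrite s0.
by rewrite /uhlenbeck /gamma !gE // /alpha; ring.
Qed.

Lemma uhlenbeck_Phi s p : (forall i, J ord0 i ^+ 2 + s != 0) -> P p -> D p ->
  uhlenbeck s (Phi J p) = uhlenbeck s p.
Proof.
(* The swapped form at the image is the original expression at x and L x - y. What remains is shear
   invariance, an identity in the free variable [L]. *)
move=> s0 Pp Dp; rewrite (uhlenbeck_swap s0 (Phi_points J0 Pp Dp)).
rewrite PhiE // /beta /=; set L := lambda J p.
have e x : wdot (fun i => tau i * resJ s i) x (K p.2) =
    wdot (fun i => tau i * res s i) x p.2.
  by rewrite wdot_diagmul; apply: eq_wdot => i; rewrite /resJ mulrA mulfK.
have e' x : wdot (fun i => tau i * resJ s i * J ord0 i) x (K p.2) =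
    wdot (fun i => tau i * resJ s i) x p.2.
  by rewrite wdot_diagmul; apply: eq_wdot => i; rewrite mulfK.
rewrite !wdotBl !wdotBr !wdotZl !wdotZr (wdotC _ (K p.2) p.1) !e'.
rewrite !(wdotC _ (K p.2) p.2) !e (wdotC _ p.1 p.2).
rewrite /uhlenbeck /alpha /beta /gamma; ring.
Qed.

(* [b] is the multiplier that makes the first component tangent; the second one is
   tangent by [sprod_grady]. *)
Definition ham s p : V :=
  let b := wdot tau p.1 (K (gradx s p)) / wdot tau p.1 (K p.2) in
  (2 *: (b *: K p.2 - K (gradx s p)), 2 *: grady s p).

Lemma ham_tangent s p : P p -> T p (ham s p).
Proof.
move=> /pointsP[// |h _ _]; apply/tangentP; rewrite /= !wdotZr.
rewrite wdotBr wdotZr divfK // subrr mulr0; split=> //.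
by rewrite wdotC sprod_grady mulr0.
Qed.

(** The multiplier term pairs with v as a multiple of <v_2, Q>, which is zero. *)
Lemma Omega_ham s p v : T p v -> Omega J (ham s p) v = 'd (uhlenbeck s) p v.
Proof.
move=> /tangentP[_ v2].
rewrite diff_uhlenbeck OmegaE /= wdotZl wdotZr wdotBr wdotZr.
by rewrite !wdot_tauJK // (wdotC tau v.2 p.2) v2 (wdotC tau v.2); ring.
Qed.

Lemma poisson_uhlenbeck s t p :
  (forall i, J ord0 i ^+ 2 + s != 0) -> (forall i, J ord0 i ^+ 2 + t != 0) ->
  P p -> poisson (Pstar J c) (Omega J) (uhlenbeck s) (uhlenbeck t) p = 0.
Proof.
move=> s0 t0 Pp; rewrite /poisson.
rewrite !(ham_vecE J0 Pp (ham_tangent _ Pp) (fun v => @Omega_ham _ p v)).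
have [->|st] := eqVneq s t; first by rewrite OmegaE subrr.
rewrite Omega_ham; last exact: ham_tangent.
rewrite diff_uhlenbeck /= !wdotZr (wdotBr (tauJ J)) wdotZr !wdot_tauJK //.
(* The multiplier disappears, leaving the canonical bracket in x and y. *)
rewrite sprod_grady mulr0 sub0r.
pose A := wdot (fun i => tau i * res s i * res t i) p.2 p.2.
pose B := wdot (fun i => tau i * res s i * resJ t i) p.2 p.1.
pose C := wdot (fun i => tau i * resJ s i * resJ t i) p.1 p.1.
have rr i : (t - s) * (res s i * res t i) = res s i - res t i.
  by rewrite /res; field; rewrite s0 t0.
have eA : (t - s) * A = alpha s p - alpha t p.
  rewrite /A /alpha /wdot mulr_sumr -sumrB; apply: eq_bigr => i _.
  transitivity (tau i * ((t - s) * (res s i * res t i)) *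
    p.2 i ord0 * p.2 i ord0).
    by ring.
  by rewrite rr; ring.
have eB : (t - s) * B = beta s p - beta t p.
  rewrite /B /beta /wdot mulr_sumr -sumrB; apply: eq_bigr => i _.
  transitivity (tau i * ((t - s) * (res s i * res t i)) *
    J ord0 i * p.2 i ord0 * p.1 i ord0).
    by rewrite /resJ; ring.
  by rewrite rr /resJ; ring.
have eC : (t - s) * C = gamma s p - gamma t p.
  rewrite /C /gamma opprB addrA addrNK /wdot mulr_sumr -sumrB.
  apply: eq_bigr => i _.
  transitivity (tau i * ((t - s) * (res s i * res t i)) *
    J ord0 i ^+ 2 * p.1 i ord0 * p.1 i ord0).
    by rewrite /resJ; ring.
  by rewrite rr /resJ; ring.
have ts : t - s != 0 by rewrite subr_eq0 eq_sym.
apply: (mulfI ts); rewrite mulr0.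
have xA : wdot tau (diagmul (res s) p.2) (diagmul (res t) p.2) = A.
  by rewrite wdot_diagmul wdot_diagmull; apply: eq_wdot => i; ring.
have xB : wdot tau (diagmul (res s) p.2) (diagmul (resJ t) p.1) = B.
  by rewrite wdot_diagmul wdot_diagmull; apply: eq_wdot => i; ring.
have yB : wdot tau (diagmul (resJ s) p.1) (diagmul (res t) p.2) = B.
  rewrite wdot_diagmul wdot_diagmull wdotC; apply: eq_wdot => i.
  by rewrite /resJ; ring.
have xC : wdot tau (diagmul (resJ s) p.1) (diagmul (resJ t) p.1) = C.
  by rewrite wdot_diagmul wdot_diagmull; apply: eq_wdot => i; ring.
have e1 : wdot tau (gradx s p) (grady t p) =
    gamma s p * alpha t p * B - gamma s p * beta t p * A
    - beta s p * alpha t p * C + beta s p * beta t p * B.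
  rewrite /gradx /grady !wdotBl !wdotBr !wdotZl !wdotZr xA xB yB xC; ring.
have e2 : wdot tau (gradx t p) (grady s p) =
    alpha s p * gamma t p * B - alpha s p * beta t p * C
    - beta s p * gamma t p * A + beta s p * beta t p * B.
  rewrite wdotC /gradx /grady !wdotBl !wdotBr !wdotZl !wdotZr xA xB yB xC; ring.
rewrite ?(wdotC tau (grady s p)) e1 e2.
(* Multiplied by t - s, the bracket is 4 times the triple product of a_s, a_t and (t - s)(A, B, C),
   where a = (alpha, beta, gamma). The last vector equals a_s - a_t, so the product vanishes. *)
transitivity (4 * ((gamma s p * alpha t p - alpha s p * gamma t p) * ((t - s) * B)
  + (beta s p * gamma t p - gamma s p * beta t p) * ((t - s) * A)
  + (alpha s p * beta t p - beta s p * alpha t p) * ((t - s) * C))).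
  by ring.
by rewrite eA eB eC; ring.
Qed.

End Integrals.

(** * Functional independence *)

Section Genericity.
Context {R : realType}.

Lemma near_root_neq0 (p : {poly R}) (a : R) : p != 0 ->
  \forall t \near a^'%classic, ~~ root p t.
Proof.
move=> p0; have [m [q + ->]] := multiplicity_XsubC p a.
rewrite p0 /= => qa.
have q1 : \forall t \near a^'%classic, q.[t] != 0.
  have cq := @continuous_horner R q a.
  by apply: nbhs_dnbhs; exact: (cvgr_neq0 _ cq).
near=> t; rewrite rootE !hornerE mulf_neq0 //; first by near: t.
rewrite expf_neq0 // subr_eq0; near: t; exact: nbhs_dnbhs_neq.
Unshelve. all: by end_near. Qed.

(** A + t B is singular only when t is an eigenvalue of - B^-1 A, and the roots of a characteristic
    polynomial are isolated. *)
Lemma near_det_affine_neq0 m (A B : 'M[R]_m) : B \in unitmx ->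
  \forall t \near (0 : R)^'%classic, \det (A + t *: B) != 0.
Proof.
move=> uB; set C := - (invmx B *m A).
have := near_root_neq0 0 (monic_neq0 (char_poly_monic C)).
apply: filterS => t; rewrite -eigenvalue_root_char /eigenvalue /eigenspace.
rewrite negbK kermx_eq0 row_free_unit unitmxE unitfE => Ct.
have -> : A + t *: B = - B *m (C - t%:M).
  rewrite mulmxBr mulmxN mulNmx opprK mulNmx opprK mulKVmx //.
  by rewrite -scalemx1 -scalemxAr mulmx1.
by rewrite det_mulmx mulf_neq0 // -unitfE -unitmxE -scaleN1r unitmxZ ?unitrN1.
Qed.

Lemma det_continuous (T : topologicalType) m (M : T -> 'M[R]_m) :
  (forall i j, continuous (fun t => M t i j)) ->
  continuous (fun t => \det (M t)).
Proof.
move=> cM; apply: (continuous_big (op := +%R)) => [x|s _].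
  exact: add_continuous.
have cp : continuous (fun t => \prod_i M t i (s i)).
  by apply: (@continuous_big R _ *%R) => [|i _];
    [exact: mul_continuous|exact: cM].
by move=> t; apply: cvgM; [exact: cvg_cst|exact: cp].
Qed.

End Genericity.

(** Clearing denominators gives a polynomial of degree below m with the m roots x_i, hence zero; its
    value at - y_s retains only the term of b_s. *)
Lemma cauchy_free (F : fieldType) m (x y b : 'I_m -> F) :
  injective x -> injective y -> (forall i s, x i + y s != 0) ->
  (forall i, \sum_s b s / (x i + y s) = 0) -> forall s, b s = 0.
Proof.
move=> xI yI xy0 e s.
pose p := \sum_s b s *: \prod_(r | r != s) ('X + (y r)%:P).
have p0 : p = 0.
  apply: (@roots_geq_poly_eq0 _ _ (codom x)).
  - apply/allP => _ /codomP[i ->]; rewrite rootE /p horner_sum.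
    pose N := \prod_r (x i + y r).
    apply/eqP; transitivity (N * \sum_s b s / (x i + y s)); last first.
      by rewrite e mulr0.
    rewrite mulr_sumr; apply: eq_bigr => r _; rewrite hornerZ horner_prod /N.
    under eq_bigr => j _ do rewrite hornerD hornerX hornerC.
    by rewrite [in RHS](bigD1 r) //=; field; exact: xy0.
  - by rewrite /codom map_inj_uniq ?enum_uniq.
  - rewrite size_codom card_ord; apply: (leq_trans (size_sum _ _ _)).
    apply/bigmax_leqP => r _; apply: (leq_trans (size_scale_leq _ _)).
    rewrite -big_filter.
    under eq_bigr => j _ do rewrite -[y j]opprK polyCN.
    rewrite size_prod_XsubC -sum1_size big_filter sum1_card cardC1 card_ord.
    by rewrite prednK // (leq_ltn_trans _ (ltn_ord r)).
have : p.[- y s] = 0 by rewrite p0 horner0.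
rewrite /p horner_sum (bigD1 s) //= [X in _ + X]big1 => [|r rs].
  rewrite addr0 hornerZ horner_prod => /eqP; rewrite mulf_eq0 => /orP[/eqP //|].
  move=> /prodf_eq0[r rs]; rewrite !hornerE addrC subr_eq0 => /eqP /yI e'.
  by rewrite e' eqxx in rs.
rewrite hornerZ horner_prod (bigD1 s) /= 1?eq_sym //.
by rewrite hornerD hornerX hornerC addNr mul0r mulr0.
Qed.

(** * Minors of the matrix of y-gradients *)

Section Independence.
Context {R : realType} {k l : nat}.
Variables (J : 'rV[R]_(k + l)) (c : R).
Hypothesis J0 : forall i, J ord0 i != 0.
Hypothesis J2 : forall i j, i != j -> J ord0 i ^+ 2 != J ord0 j ^+ 2.

Local Notation n := (k + l)%N.
Local Notation V := (@phase R k l).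
Local Notation K := (diagmul (fun i => (J ord0 i)^-1)).
Local Notation tau := (@tau R k l).
Local Notation P := (points (Pstar J c)).
Implicit Types (x y q Q : 'cV[R]_n) (p u v : V) (s t : R).

(** The shift by one makes the nodes positive, which keeps J_i^2 + s away from zero. *)
Definition node m (s : 'I_m) : R := (s : nat).+1%:R.

Lemma node_inj m : injective (@node m).
Proof. by move=> s t /eqP; rewrite /node eqr_nat eqSS => /eqP /val_inj. Qed.

Lemma node_neq0 m (s : 'I_m) i : J ord0 i ^+ 2 + node s != 0.
Proof. by rewrite gt_eqF // ltr_wpDl ?sqr_ge0 // ltr0n. Qed.

Variables (m : nat) (f : 'I_m -> 'I_n) (i0 : 'I_n).
Hypotheses (f_inj : injective f) (f_i0 : forall i, f i != i0).

Definition minor p : 'M[R]_m := \matrix_(s, i) grady J (node s) p (f i) ord0.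

(** Basis vectors in q, made tangent along J^-1 Q, suffice as test vectors: by [sprod_grady] the
    correction does not change the differentials. *)
Lemma independent_minor p : P p -> \det (minor p) != 0 ->
  independent_at (Pstar J c) (fun s : 'I_m => uhlenbeck J c (node s)) p.
Proof.
move=> /pointsP[// |h _ _] d0 a a0.
have row0 : (\row_s a s) *m minor p = 0.
  apply/rowP => i; rewrite !mxE.
  have := a0 _ (tangent_shift1 c (delta_mx (f i) ord0) h).
  under eq_bigr => s _.
    rewrite diff_uhlenbeck /= linear0r add0r wdotBr wdotZr wdot_tauJK //.
    rewrite sprod_grady mulr0 subr0 wdot_delta.
    over.
  move=> e; apply: (mulfI (_ : 2 * tauJ J (f i) != 0)).
    by rewrite mulf_neq0 ?pnatr_eq0 ?tauJ_neq0.
  rewrite mulr0 -[RHS]e [LHS]mulr_sumr; apply: eq_bigr => s _; rewrite !mxE; ring.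
have uB : minor p \in unitmx by rewrite unitmxE unitfE.
have /rowP r0 : \row_s a s = 0 by rewrite -(mulmxK uB (\row_s a s)) row0 mul0mx.
by move=> s; have := r0 s; rewrite !mxE.
Qed.

(** Moving q along J^-1 Q is the shear y -> y + s x, under which the y-gradient is invariant. *)
Lemma minor_affine q e Q s t : minor (q + t *: e + s *: K Q, Q) =
  minor (q, Q) + t *: minor (e, Q).
Proof.
apply/matrixP => r i; rewrite !mxE /beta /= !wdotDr !wdotZr.
have -> : wdot (fun i => tau i * resJ J (node r) i) Q (K Q) =
    alpha J (node r) (Q, Q).
  by rewrite wdot_diagmul; apply: eq_wdot => j; rewrite /resJ mulrA mulfK.
by rewrite /alpha /resJ /=; field.
Qed.

(* Up to the scaling of rows and columns this is a Cauchy matrix. *)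
Lemma minor_delta Q : (forall i, Q i ord0 != 0) ->
  minor (delta_mx i0 ord0, Q) \in unitmx.
Proof.
move=> Q0; rewrite -row_free_unit -kermx_eq0; apply/rowV0P => a /sub_kermxP aB.
apply/rowP => s; rewrite mxE.
pose b (s : 'I_m) := a ord0 s * res J (node s) i0.
suff bs : b s = 0.
  move/eqP: bs; rewrite mulf_eq0 invr_eq0 (negPf (node_neq0 s i0)) orbF.
  by move/eqP.
have xI : injective (fun i : 'I_m => J ord0 (f i) ^+ 2).
  by move=> i j /eqP e; apply: f_inj; apply/eqP; apply: contraTT e => /J2.
apply: (cauchy_free xI (@node_inj m)) => [i r|i]; first exact: node_neq0.
have := congr1 (fun M : 'rV_m => M ord0 i) aB; rewrite !mxE.
(* Since [f i] differs from [i0], the alpha term of the gradient vanishes and only the product of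
   resolvents at [i0] and [f i] remains. *)
under eq_bigr => r _.
  rewrite !mxE /beta wdot_delta (negPf (f_i0 i)).
  over.
move=> e.
apply: (mulfI (_ : tau i0 * J ord0 i0 * Q i0 ord0 * Q (f i) ord0 != 0)).
  by rewrite !mulf_neq0 ?tau_neq0.
rewrite mulr0 -[RHS]oppr0 -[in RHS]e mulr_sumr -sumrN; apply: eq_bigr => r _.
rewrite /b /resJ /res /=.
move: (node r) (node_neq0 r (f i)) (node_neq0 r i0) => z zf z0.
by field; rewrite zf z0.
Qed.

Lemma minor_continuous : continuous (fun p => \det (minor p)).
Proof.
apply: det_continuous => r i p.
have Cq := Ck_coord 0 setT (f i) (@fst_continuous 'cV[R]_n 'cV[R]_n).
have CQ := Ck_coord 0 setT (f i) (@snd_continuous 'cV[R]_n 'cV[R]_n).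
have Ca : Ck 0 setT (alpha J (node r)).
  exact: Ck_wdot (@snd_continuous _ _) (@snd_continuous _ _) openT.
have Cb : Ck 0 setT (beta J (node r)).
  exact: Ck_wdot (@snd_continuous _ _) (@fst_continuous _ _) openT.
have C0 a := @Ck_cst R V R^o 0 setT a.
have C := CkD openT (CkZ openT (CkZ openT (C0 (resJ J (node r) (f i))) Ca) Cq)
  (CkZ openT (CkZ openT (C0 (- res J (node r) (f i))) Cb) CQ).
apply: (eq_Ck openT _ C) => // u _; rewrite !mxE /cst /GRing.scale /=; ring.
Qed.

End Independence.

(** The root with rationalised numerator, S standing for the square root of 1 - a c / b^2. It makes
    sense for a = 0 and tends to 0 with c. *)
Lemma quadratic_small_root (F : fieldType) (a b c S : F) :
  b != 0 -> 1 + S != 0 -> S ^+ 2 = 1 - a * c * b ^- 2 ->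
  let s := - c * (b * (1 + S))^-1 in c + 2 * s * b + s ^+ 2 * a = 0.
Proof.
move=> b0 S1 S2 s; have ac : a * c = b ^+ 2 * (1 - S ^+ 2) by rewrite S2; field.
transitivity (c + 2 * s * b + c * (a * c) / (b * (1 + S)) ^+ 2).
  by congr (_ + _); rewrite /s; field; rewrite S1 b0.
by rewrite ac /s; field; rewrite S1 b0.
Qed.

(** * Small displacements inside a quadric *)

Section Density.
Context {R : realType} {n : nat}.
Implicit Types (w : 'I_n -> R) (x y : 'cV[R]_n).

Local Open Scope classical_set_scope.

Let cvg_id0 : t @[t --> (0 : R)^'] --> (0 : R).
Proof. exact: nbhs_dnbhs. Qed.

Let cvg_sqrt1 (f : R -> R) : f t @[t --> (0 : R)^'] --> (0 : R) ->
  Num.sqrt (1 - f t) @[t --> (0 : R)^'] --> (1 : R).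
Proof.
move=> f0; have f1 : 1 - f t @[t --> (0 : R)^'] --> (1 : R).
  by rewrite -[X in _ --> X]subr0; apply: cvgB => //; exact: cvg_cst.
rewrite -[X in _ --> X]sqrtr1.
have cS : {for (1 : R), continuous (@Num.sqrt R)} by exact: sqrt_continuous.
exact: (continuous_cvg _ cS f1).
Qed.

(* The vanishing coordinates become [t], and one nonvanishing coordinate is
   rescaled to restore the value of the quadratic form. *)
Lemma quadric_near_coord_neq0 w x A :
  (forall i, w i != 0) -> x != 0 -> nbhs x A ->
  exists y, [/\ A y, wdot w y y = wdot w x x & forall i, y i ord0 != 0].
Proof.
move=> w0 xn0 nA.
have [j xj] : exists j, x j ord0 != 0.
  apply: contrapT => /forallNP xj; case/eqP: xn0; apply/colP => i.
  by rewrite mxE; apply/eqP/negPn/negP; exact: xj.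
(* The new coordinates add t^2 z to the form; the factor [r t] removes the same amount from the term
   of index [j]. *)
pose z := \sum_(i | x i ord0 == 0) w i.
pose a := z / (w j * x j ord0 ^+ 2).
pose r (t : R) := Num.sqrt (1 - t ^+ 2 * a).
pose y t : 'cV[R]_n := \col_i (if x i ord0 == 0 then t else
  if i == j then x j ord0 * r t else x i ord0).
have ca : t ^+ 2 * a @[t --> (0 : R)^'] --> (0 : R).
  have e : 0 * 0 * a = 0 by rewrite !mul0r.
  rewrite -[X in _ --> X]e.
  by apply: cvgM; [exact: cvgM|exact: cvg_cst].
have cr : r t @[t --> (0 : R)^'] --> (1 : R) by exact: cvg_sqrt1.
have cxr : x j ord0 * r t @[t --> (0 : R)^'] --> x j ord0.
  by rewrite -[X in _ --> X]mulr1; apply: cvgM => //; exact: cvg_cst.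
have cy : y t @[t --> (0 : R)^'] --> x.
  apply: cvg_col => i; under eq_cvg do rewrite mxE.
  have [->|xi] := eqVneq (x i ord0) 0; first exact: cvg_id0.
  have [->|ij] := eqVneq i j; last exact: cvg_cst.
  exact: cxr.
near ((0 : R)^') => t.
have t0 : t != 0 by near: t; exact: nbhs_dnbhs_neq.
have r0 : 0 < r t by near: t; apply: (cvgr_gt _ cr); exact: ltr01.
have r2 : r t ^+ 2 = 1 - t ^+ 2 * a.
  (* [Num.sqrt] is 0 on negative numbers, so a positive root certifies a positive radicand. *)
  by rewrite sqr_sqrtr // ltW // -sqrtr_gt0.
exists (y t); split; first by near: t; exact: cy.
- transitivity (\sum_i (w i * x i ord0 * x i ord0 +
      ((if x i ord0 == 0 then t ^+ 2 * w i else 0) -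
       (if i == j then t ^+ 2 * z else 0)))).
    apply: eq_bigr => i _; rewrite mxE.
    have [xi|xi] := eqVneq (x i ord0) 0.
      rewrite (_ : i == j = false) ?subr0 ?xi; first by ring.
      by apply: contraNF xj => /eqP <-; rewrite xi.
    have [->|ij] := eqVneq i j; last by ring.
    transitivity (w j * x j ord0 ^+ 2 * r t ^+ 2); first by ring.
    by rewrite r2 /a; field; rewrite w0 xj.
  rewrite big_split sumrB /= -big_mkcond -mulr_sumr -/z -big_mkcond big_pred1_eq.
  by rewrite subrr addr0.
- move=> i; rewrite mxE; case: ifP => // /negbT xi; case: ifP => // _.
  by rewrite mulf_neq0 // gt_eqF.
Unshelve. all: by end_near. Qed.

(* The line through [q + t e] in the direction [d], transversal to the quadric
   at [q], meets the quadric again close to [q]. *)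
Lemma quadric_near_shift w (q d e : 'cV[R]_n) A (B : set R) :
  wdot w q d != 0 -> nbhs q A -> (\forall t \near (0 : R)^', B t) ->
  exists t s, [/\ A (q + t *: e + s *: d), B t &
    wdot w (q + t *: e + s *: d) (q + t *: e + s *: d) = wdot w q q].
Proof.
move=> qd nA nB.
(* The form at q + t e + s d exceeds its value at q by C + 2 s b + s^2 a. As C tends to 0 with t, so
   does the root [s t]. *)
pose b (t : R) := wdot w q d + t * wdot w e d.
pose C (t : R) := t * (2 * wdot w q e + t * wdot w e e).
pose a := wdot w d d.
pose S t := Num.sqrt (1 - a * C t * (b t ^- 2)).
pose s t := - C t * (b t * (1 + S t))^-1.
have cb : b t @[t --> (0 : R)^'] --> wdot w q d.
  have e0 : wdot w q d + 0 * wdot w e d = wdot w q d by rewrite mul0r addr0.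
  rewrite -[X in _ --> X]e0.
  by apply: cvgD; [|apply: cvgM => //]; exact: cvg_cst.
have cC : C t @[t --> (0 : R)^'] --> (0 : R).
  rewrite -[X in _ --> X](mul0r (2 * wdot w q e + 0 * wdot w e e)).
  by apply: cvgM => //; apply: cvgD; [|apply: cvgM => //]; exact: cvg_cst.
have cS : S t @[t --> (0 : R)^'] --> (1 : R).
  apply: cvg_sqrt1; rewrite -[X in _ --> X](mul0r (wdot w q d ^- 2)).
  apply: cvgM; last by apply: cvgV; [exact: expf_neq0|exact: cvgM].
  by rewrite -[X in _ --> X](mulr0 a); apply: cvgM => //; exact: cvg_cst.
have cs : s t @[t --> (0 : R)^'] --> (0 : R).
  rewrite -[X in _ --> X](mul0r (wdot w q d * (1 + 1))^-1).
  apply: cvgM; first by rewrite -[X in _ --> X]oppr0; exact: cvgN.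
  apply: cvgV; first by rewrite mulf_neq0.
  by apply: cvgM => //; apply: cvgD => //; exact: cvg_cst.
have cq : q + t *: e + s t *: d @[t --> (0 : R)^'] --> q.
  have e0 : q + 0 *: e + 0 *: d = q by rewrite !scale0r !addr0.
  rewrite -[X in _ --> X]e0.
  apply: cvgD; last by apply: cvgZr_tmp.
  by apply: cvgD; [exact: cvg_cst|apply: cvgZr_tmp].
near ((0 : R)^') => t.
have b0 : b t != 0 by near: t; exact: (cvgr_neq0 _ cb).
have S0 : 0 < S t by near: t; apply: (cvgr_gt _ cS); exact: ltr01.
have S2 : S t ^+ 2 = 1 - a * C t * (b t ^- 2).
  by rewrite sqr_sqrtr // ltW // -sqrtr_gt0.
exists t, (s t); split; [by near: t; exact: cq|by near: t|].
transitivity (wdot w q q + (C t + 2 * s t * b t + s t ^+ 2 * a)).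
  rewrite !wdotDl !wdotDr !wdotZl !wdotZr (wdotC w e q) (wdotC w d q).
  by rewrite (wdotC w d e) /C /b /a; ring.
have S1 : 1 + S t != 0 by rewrite gt_eqF // addr_gt0.
by rewrite /s quadratic_small_root // addr0.
Unshelve. all: by end_near. Qed.

End Density.

(** * Density of the points with nonzero minor *)

Section Generic.
Context {R : realType} {k l : nat}.
Variables (J : 'rV[R]_(k + l)) (c : R).
Hypothesis J0 : forall i, J ord0 i != 0.
Hypothesis J2 : forall i j, i != j -> J ord0 i ^+ 2 != J ord0 j ^+ 2.

Local Notation n := (k + l)%N.
Local Notation K := (diagmul (fun i => (J ord0 i)^-1)).
Local Notation tau := (@tau R k l).
Local Notation P := (points (Pstar J c)).

Lemma minor_dense m (f : 'I_m -> 'I_n) i0 :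
  injective f -> (forall i, f i != i0) ->
  (P `<=` closure (P `&` [set p | \det (minor J f p) != 0]))%classic.
Proof.
move=> f_inj f_i0 [q Q] /pointsP[// |/= h hq hQ] A [[A1 A2] /= [nA1 nA2] A12].
have Q0 : Q != 0 by apply: contraNneq h => ->; rewrite linear0 linear0r.
have cK : continuous (fun Q : 'cV[R]_n => wdot tau q (K Q)).
  move=> x; apply: (@continuous_comp _ _ _ K (wdot tau q)).
    exact: diagmul_continuous.
  exact: wdotr_continuous.
have nh : \forall Q' \near Q, wdot tau q (K Q') != 0.
  exact: (cvgr_neq0 _ (cK Q)).
(* Q moves first, with q fixed, staying close enough to keep <q, J^-1 Q'> nonzero: this is the
   transversality for the later move of q. *)
have [Q' [[A2Q' h'] hQ' Q'0]] :=
  quadric_near_coord_neq0 (@tau_neq0 R k l) Q0 (filterI nA2 nh).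
have ch : continuous (fun q : 'cV[R]_n => wdot tau q (K Q')).
  by under eq_fun do rewrite wdotC; exact: wdotr_continuous.
have nh' : \forall q' \near q, wdot tau q' (K Q') != 0.
  exact: (cvgr_neq0 _ (ch q)).
have nd := near_det_affine_neq0 (minor J f (q, Q'))
  (minor_delta J0 J2 f_inj f_i0 Q'0).
have [t [s [[A1q' h1] d q'q]]] :=
  quadric_near_shift (delta_mx i0 ord0) h' (filterI nA1 nh') nd.
exists (q + t *: delta_mx i0 ord0 + s *: K Q', Q'); split; last exact: A12.
split; first by apply/pointsP => //; split=> //=; rewrite ?q'q ?hQ'.
by rewrite /= minor_affine.
Qed.

End Generic.

(** * Complete integrability of the Heisenberg map *)

Unset Implicit Arguments.
Set Strict Implicit.

Theorem theorem3p2 (R : realType) (k l : nat) (c : R) (J : 'rV[R]_(k + l))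
  (hk : (1 <= k)%N) (hl : (1 <= l)%N)
  (hc : c = 1 \/ c = -1 \/ c = 0)
  (hJ0 : forall i, J ord0 i != 0)
  (hJ2 : forall i j, i != j -> J ord0 i ^+ 2 != J ord0 j ^+ 2) :
  symplectic_manifold (Pstar J c) (Omega J) (2 * (k + l) - 2)%N /\
  completely_integrable (Pstar J c) (Omega J) (Phi_dom J) (Phi J) (k + l - 1)%N.
Proof.
have sM := Pstar_symplectic c hJ0; split=> //.
have n_gt0 : (0 < k + l)%N by rewrite addn_gt0 hk.
have en : ((k + l - 1).+1 = k + l)%N by rewrite subn1 prednK.
(* All coordinates but the last, which plays the part of [i0]. *)
pose f (i : 'I_(k + l - 1)) := cast_ord en (lift ord_max i).
have f_inj : injective f by move=> i j /cast_ord_inj /lift_inj.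
have f_i0 i : f i != cast_ord en ord_max.
  by rewrite /f (inj_eq (@cast_ord_inj _ _ _)) eq_sym neq_lift.
split.
- by rewrite mulnBr muln1.
- by split; [exact: Phi_dom_open|exact: Phi_smooth].
- exact: Phi_points.
- by move=> p _ Dp u v Tu Tv; exact: (Phi_symplectic hJ0 Dp Tu Tv).
exists (fun s => uhlenbeck J c (node s)); split.
(* The integrals are polynomial in (q, Q), hence smooth on the whole space. *)
- exists setT; split; [exact: openT|by []|].
  by move=> s; apply: uhlenbeck_smooth; exact: openT.
- by move=> s p Pp Dp; apply: uhlenbeck_Phi => // i; exact: node_neq0.
- by move=> s t p Pp; apply: poisson_uhlenbeck => // i; exact: node_neq0.
exists [set p | \det (minor J f p) != 0]%classic; split.
- apply: (@open_comp _ _ (fun p => \det (minor J f p)) [set x | x != 0]%classic).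
    by move=> p _; exact: minor_continuous.
  exact: open_neq.
- exact: minor_dense f_inj f_i0.
- by move=> p Pp d; exact: (independent_minor hJ0 Pp d).
Qed.
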